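(* Suppose that $g$ is Lipschitz continuous on $\mathbb R^m$ and that the dual center $\dot y=\bar y^c$ is fixed, where $\bar y^c$ is the prox-center of $p_{\mathcal Y}$. Then $D_{\mathcal Y}:=\sup_y\{b_{\mathcal Y}(y,\dot y)\mid y\in\mathrm{dom}(g^* )\}<+\infty$. Let $\beta_1>0$ and let $b_{\mathcal Y}$ be chosen such that $L_{b_{\mathcal Y}}=1$. Let $\{\bar x^k\}$ be the primal sequence generated by Algorithm 1 (ASGARD, described in the context). Then, for every primal solution $x^\star\in\mathcal X^\star$, $$P(\bar x^k)-P^\star\le\frac{\bar L_A}{2\beta_1k}\|\bar x^0-x^\star\|_{\mathcal X}^2+\frac{2\beta_1}{k+1}D_{\mathcal Y}\qquad\text{for all }k\ge1.$$
   Context: Setting. $f:\mathbb R^n\to\mathbb R\cup\{+\infty\}$ and $g:\mathbb R^m\to\mathbb R\cup\{+\infty\}$ are proper, closed, convex, and $A\in\mathbb R^{m\times n}$. Primal problem: $P^\star=\min_{x\in\mathbb R^n}\{P(x):=f(x)+g(Ax)\}$, solution set $\mathcal X^\star$. $g^*$ is the Fenchel conjugate of $g$. Put $\mathcal X:=\overline{\mathrm{dom}(f)}$, $\mathcal Y:=\overline{\mathrm{dom}(g^* )}$. Standing assumption: $\mathcal X^\star\ne\emptyset$ and $0\in\mathrm{ri}(\mathrm{dom}(g)-A(\mathrm{dom} f))$. Norms. $\|\cdot\|_{\mathcal X}$, $\|\cdot\|_{\mathcal Y}$ are weighted Euclidean norms on $\mathbb R^n$, $\mathbb R^m$ (of the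 form $\|z\|=\|Sz\|_2$ with $S^\top S$ positive definite), with dual norms $\|u\|_{\cdot,*}=\max\{\langle u,v\rangle:\|v\|=1\}$. $\bar L_A:=\|A\|^2=\max_{x}\|Ax\|_{\mathcal Y,*}^2/\|x\|_{\mathcal X}^2$. Bregman distance. $p_{\mathcal Y}$ is continuous, $1$-strongly convex and differentiable with $L_{b_{\mathcal Y}}$-Lipschitz gradient with respect to $\|\cdot\|_{\mathcal Y}$ ($L_{b_{\mathcal Y}}\ge1$), $\mathcal Y\subseteq\mathrm{dom}(p_{\mathcal Y})$; its prox-center is $\bar y^c:=\arg\min\{p_{\mathcal Y}(y):y\in\mathrm{dom}(p_{\mathcal Y})\}$, normalized so that $p_{\mathcal Y}(\bar y^c)=0$; and $b_{\mathcal Y}(y,\dot y)=p_{\mathcal Y}(y)-p_{\mathcal Y}(\dot y)-\langle\nabla p_{\mathcal Y}(\dot y),y-\dot y\rangle$. Algorithm 1 (ASGARD). Given $\dot y$, $\beta_1>0$, $\tau_0:=1$, $\bar x^0\in\mathcal X$, $\hat x^0:=\bar x^0$. For $k=0,1,2,\dots$: (1) $\tau_{k+1}\in(0,1)$ is the unique positive root of $\tau^3/L_{b_{\mathcal Y}}+\tau^2+\tau_k^2\tau-\tau_k^2=0$; (2) $y^*_{k}:=\arg\max_{y\in\mathcal Y}\{\langle A\hat x^k,y\rangle-g^*(y)-\beta_{k+1}b_{\mathcal Y}(y,\dot y)\}$; (3) $\bar x^{k+1}:=\arg\min_{x}\{f(x)+\langle A^\top y^*_k,x-\hat x^k\rangle+\frac{\bar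 L_A}{2\beta_{k+1}}\|x-\hat x^k\|_{\mathcal X}^2\}$ (for the Euclidean norm this is the proximal step $\mathrm{prox}_{\beta_{k+1}\bar L_A^{-1}f}(\hat x^k-\beta_{k+1}\bar L_A^{-1}A^\top y^*_k)$); (4) $\hat x^{k+1}:=\bar x^{k+1}+\frac{\tau_{k+1}(1-\tau_k)}{\tau_k}(\bar x^{k+1}-\bar x^k)$ and $\beta_{k+2}:=\beta_{k+1}/(1+L_{b_{\mathcal Y}}^{-1}\tau_{k+1})$. *)

(* Defs.v *)
From HB Require Import structures.
From mathcomp Require Import all_boot all_order all_algebra.
From mathcomp Require Import all_classical all_reals all_analysis.

Set Implicit Arguments.
Unset Strict Implicit.
Unset Printing Implicit Defensive.

Import Order.TTheory GRing.Theory Num.Theory.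
Import numFieldNormedType.Exports.

Local Open Scope classical_set_scope.
Local Open Scope ring_scope.

Definition dot (R : realType) (n : nat) (u v : 'cV[R]_n) : R :=
  \sum_(i < n) u i 0 * v i 0.

Definition posdef (R : realType) (n : nat) (M : 'M[R]_n) : Prop :=
  forall z : 'cV[R]_n, z != 0 -> 0 < dot z (M *m z).

(* The topology on 'cV[R]_n is that of the library's sup norm `| . |, which is
   equivalent to the norms below. *)
Definition wnorm (R : realType) (q n : nat) (S : 'M[R]_(q, n))
    (z : 'cV[R]_n) : R :=
  Num.sqrt (dot (S *m z) (S *m z)).

(* The suprema in [dual_norm] and [opnorm] are attained when S^T S is positive
   definite. *)
Definition dual_norm (R : realType) (q n : nat) (S : 'M[R]_(q, n))
    (u : 'cV[R]_n) : R :=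
  sup [set dot u v | v in [set v | wnorm S v = 1]].

Definition opnorm (R : realType) (q r n m : nat) (SX : 'M[R]_(q, n))
    (SY : 'M[R]_(r, m)) (A : 'M[R]_(m, n)) : R :=
  sup [set dual_norm SY (A *m x) / wnorm SX x | x in [set x | x != 0]].

Definition LA (R : realType) (q r n m : nat) (SX : 'M[R]_(q, n))
    (SY : 'M[R]_(r, m)) (A : 'M[R]_(m, n)) : R :=
  opnorm SX SY A ^+ 2.

Section Convex.
Local Open Scope ereal_scope.

Definition dom (R : realType) (n : nat) (f : 'cV[R]_n -> \bar R) :
  set 'cV[R]_n := [set x | f x < +oo].

Definition proper_efun (R : realType) (n : nat) (f : 'cV[R]_n -> \bar R) : Prop :=
  (forall x, f x != -oo) /\ dom f !=set0.

Definition econvex (R : realType) (n : nat) (f : 'cV[R]_n -> \bar R) : Prop :=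
  forall (x y : 'cV[R]_n) (t : R), (0 < t < 1)%R ->
    f (t *: x + (1 - t) *: y)%R <= t%:E * f x + (1 - t)%:E * f y.

Definition strongly_convex (R : realType) (q n : nat) (S : 'M[R]_(q, n))
    (mu : R) (f : 'cV[R]_n -> \bar R) : Prop :=
  forall (x y : 'cV[R]_n) (t : R), (0 < t < 1)%R ->
    f (t *: x + (1 - t) *: y)%R
      + (mu / 2 * t * (1 - t) * wnorm S (x - y) ^+ 2)%:E
    <= t%:E * f x + (1 - t)%:E * f y.

Definition fconj (R : realType) (n : nat) (g : 'cV[R]_n -> \bar R)
    (y : 'cV[R]_n) : \bar R :=
  ereal_sup [set (dot u y)%:E - g u | u in setT].

Definition is_argmin (T : Type) (R : realType) (D : set T) (F : T -> \bar R)
    (x : T) : Prop := D x /\ forall z, D z -> F x <= F z.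

Definition is_argmax (T : Type) (R : realType) (D : set T) (F : T -> \bar R)
    (x : T) : Prop := D x /\ forall z, D z -> F z <= F x.

Definition affine_hull (R : realType) (n : nat) (C : set 'cV[R]_n) :
  set 'cV[R]_n :=
  [set x | exists (k : nat) (c : 'I_k -> R) (z : 'I_k -> 'cV[R]_n),
     [/\ forall i, C (z i), (\sum_i c i = 1)%R & x = (\sum_i c i *: z i)%R]].

Definition relint (R : realType) (n : nat) (C : set 'cV[R]_n) :
  set 'cV[R]_n :=
  [set x | C x /\ \forall z \near within (affine_hull C) (nbhs x), C z].

(* [v] is a gradient of [p] at [y] relative to [dom p]: the Frechet condition
   is required along points of [dom p] only.  At an interior point of [dom p]
   this is ordinary differentiability with gradient [v]; the relative form also
   makes sense on the boundary of a domain which is not open. *)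
Definition is_gradient (R : realType) (n : nat) (p : 'cV[R]_n -> \bar R)
    (y v : 'cV[R]_n) : Prop :=
  forall eps : R, (0 < eps)%R ->
    \forall z \near within (dom p) (nbhs y),
      (`|fine (p z) - fine (p y) - dot v (z - y)| <= eps * `|z - y|)%R.

Record prox_function (R : realType) (q n : nat) (S : 'M[R]_(q, n))
    (p : 'cV[R]_n -> \bar R) (gradp : 'cV[R]_n -> 'cV[R]_n) (Lb : R) : Prop := {
  prox_proper : proper_efun p ;
  prox_continuous : {within dom p, continuous p} ;
  prox_strongly_convex : strongly_convex S 1 p ;
  prox_gradient : forall y, dom p y -> is_gradient p y (gradp y) ;
  prox_lipschitz_gradient : forall y z, dom p y -> dom p z ->
    (dual_norm S (gradp y - gradp z) <= Lb * wnorm S (y - z))%R }.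

Definition prox_center (R : realType) (n : nat) (p : 'cV[R]_n -> \bar R)
    (yc : 'cV[R]_n) : Prop := is_argmin (dom p) p yc.

Definition bregman (R : realType) (n : nat) (p : 'cV[R]_n -> \bar R)
    (gradp : 'cV[R]_n -> 'cV[R]_n) (y ydot : 'cV[R]_n) : \bar R :=
  p y - p ydot - (dot (gradp ydot) (y - ydot))%:E.

Definition primal (R : realType) (n m : nat) (f : 'cV[R]_n -> \bar R)
    (g : 'cV[R]_m -> \bar R) (A : 'M[R]_(m, n)) (x : 'cV[R]_n) : \bar R :=
  f x + g (A *m x).

Definition primal_opt (R : realType) (n m : nat) (f : 'cV[R]_n -> \bar R)
    (g : 'cV[R]_m -> \bar R) (A : 'M[R]_(m, n)) : \bar R :=
  ereal_inf [set primal f g A x | x in setT].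

Definition solutions (R : realType) (n m : nat) (f : 'cV[R]_n -> \bar R)
    (g : 'cV[R]_m -> \bar R) (A : 'M[R]_(m, n)) : set 'cV[R]_n :=
  [set x | is_argmin setT (primal f g A) x].

Definition dual_diameter (R : realType) (m : nat) (g : 'cV[R]_m -> \bar R)
    (p : 'cV[R]_m -> \bar R) (gradp : 'cV[R]_m -> 'cV[R]_m)
    (ydot : 'cV[R]_m) : \bar R :=
  ereal_sup [set bregman p gradp y ydot | y in dom (fconj g)].

(* [beta 0] is not used by the algorithm: iteration k uses [beta k.+1]. *)
Record asgard (R : realType) (q r n m : nat) (SX : 'M[R]_(q, n))
    (SY : 'M[R]_(r, m)) (f : 'cV[R]_n -> \bar R) (g : 'cV[R]_m -> \bar R)
    (A : 'M[R]_(m, n)) (p : 'cV[R]_m -> \bar R)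
    (gradp : 'cV[R]_m -> 'cV[R]_m) (Lb : R) (ydot : 'cV[R]_m) (beta1 : R)
    (tau beta : nat -> R) (xbar xhat : nat -> 'cV[R]_n)
    (ystar : nat -> 'cV[R]_m) : Prop := {
  asgard_tau0 : tau 0%N = 1%R ;
  asgard_beta1 : beta 1%N = beta1 ;
  asgard_xbar0 : closure (dom f) (xbar 0%N) ;
  asgard_xhat0 : xhat 0%N = xbar 0%N ;
  asgard_tau_bounds : forall k, (0 < tau k.+1 < 1)%R ;
  asgard_tau_root : forall k,
    (tau k.+1 ^+ 3 / Lb + tau k.+1 ^+ 2 + tau k ^+ 2 * tau k.+1
      - tau k ^+ 2 = 0)%R ;
  asgard_ystar : forall k,
    is_argmax (closure (dom (fconj g)))
      (fun y => (dot (A *m xhat k) y)%:E - fconj g y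
                - (beta k.+1)%:E * bregman p gradp y ydot)
      (ystar k) ;
  asgard_xbar : forall k,
    is_argmin setT
      (fun x => f x + (dot (A^T *m ystar k) (x - xhat k))%:E
                + (LA SX SY A / (2 * beta k.+1)
                     * wnorm SX (x - xhat k) ^+ 2)%:E)
      (xbar k.+1) ;
  asgard_xhat : forall k,
    xhat k.+1 = (xbar k.+1 + (tau k.+1 * (1 - tau k) / tau k)
                               *: (xbar k.+1 - xbar k))%R ;
  asgard_beta : forall k,
    (beta k.+2 = beta k.+1 / (1 + Lb^-1 * tau k.+1))%R }.

End Convex.

(* Main.v *)
Require Import Defs.
From HB Require Import structures.
From mathcomp Require Import all_boot all_order all_algebra.
From mathcomp Require Import all_classical all_reals all_analysis.
From mathcomp Require Import ring lra.

Set Implicit Arguments.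
Unset Strict Implicit.
Unset Printing Implicit Defensive.

Import Order.TTheory GRing.Theory Num.Theory.
Import numFieldNormedType.Exports.
Local Open Scope classical_set_scope.
Local Open Scope ring_scope.

(** The proof is an accelerated-gradient argument on the smoothed Lagrangian
    [l b x y = f x + <A x, y> - g^* y - b * B y], where [B] is the Bregman
    distance to the prox-center.  Its supremum over [y] is the primal objective
    with [g] replaced by a [1 / b]-smooth approximation from below.

    One iteration, with smoothing [b], inertial point [u], dual maximizer [y]
    and new point [x1], satisfies for all [x] in [dom f] and [z] in [dom g^*]
    [[
      l b x1 z + L / (2 b) |x - x1|^2 <= l b x y + L / (2 b) |x - u|^2,
    ]]
    because the dual objective grows quadratically away from [y], the proximal
    objective grows quadratically away from [x1], and [L] is the squared norm of
    [A] ([smoothed_lagrangian_step]).  Taking [x = t xs + (1 - t) xbar] for a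
    solution [xs] and [t = tau k], convexity and the estimate
    [l b xs y <= P xs - b * B y] give a recursion for the gap to the optimal
    value.  When the smoothing decreases from [b0] to [b], [(b0 - b) * B y] is
    lost, and [- b * B y] pays for it.  The cubic equation for [tau] says that
    the recursion telescopes ([tau_beta_telescope]), so the gap of
    [l (beta k.+1)] at [xbar k.+1] is at most
    [tau k ^+ 2 / beta k.+1 * (L / 2) |xbar 0 - xs|^2] ([smoothed_gap_bound]).
    Since [tau k >= 1 / (k + 1)], this factor is at most [1 / (beta 1 * (k + 1))]
    and [beta k.+1] is at most [2 * beta 1 / (k + 2)].

    Removing the smoothing costs at most [b * D], by the Fenchel-Moreau identity
    [G u = sup_z (<u, z> - g^* z)].  For a finite convex Lipschitz [G] it follows
    from compactness of balls: minimizers of [G] plus a steep quadratic centered at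
    [u] produce affine minorants that are almost exact at [u]
    ([affine_minorant_approx]).

    The diameter [D] is finite because the Lipschitz bound on [g] makes
    [dom g^*] bounded, and the Lipschitz gradient of [p] bounds [B] by a multiple
    of the squared distance to the prox-center. *)

(** * Inner products and weighted norms *)

Lemma dotC (R : realType) n (u v : 'cV[R]_n) : dot u v = dot v u.
Proof. by apply: eq_bigr => i _; rewrite mulrC. Qed.

Lemma dotDl (R : realType) n (u v w : 'cV[R]_n) :
  dot (u + v) w = dot u w + dot v w.
Proof. by rewrite -big_split /=; apply: eq_bigr => i _; rewrite mxE mulrDl. Qed.

Lemma dotZl (R : realType) n a (u w : 'cV[R]_n) : dot (a *: u) w = a * dot u w.
Proof. by rewrite /dot mulr_sumr; apply: eq_bigr => i _; rewrite mxE mulrA. Qed.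

Lemma dotNl (R : realType) n (u w : 'cV[R]_n) : dot (- u) w = - dot u w.
Proof. by rewrite -scaleN1r dotZl mulN1r. Qed.

Lemma dotDr (R : realType) n (u v w : 'cV[R]_n) :
  dot w (u + v) = dot w u + dot w v.
Proof. by rewrite dotC dotDl !(dotC w). Qed.

Lemma dotZr (R : realType) n a (u w : 'cV[R]_n) : dot w (a *: u) = a * dot w u.
Proof. by rewrite dotC dotZl dotC. Qed.

Lemma dotNr (R : realType) n (u w : 'cV[R]_n) : dot w (- u) = - dot w u.
Proof. by rewrite dotC dotNl dotC. Qed.

Definition dotE := (dotDl, dotZl, dotNl, dotDr, dotZr, dotNr).

Lemma dot0l (R : realType) n (w : 'cV[R]_n) : dot 0 w = 0.
Proof. by rewrite -(scale0r w) dotZl mul0r. Qed.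

Lemma dot_mulmxl (R : realType) m n (A : 'M[R]_(m, n)) x y :
  dot (A *m x) y = dot x (A^T *m y).
Proof.
have E k (u v : 'cV[R]_k) : dot u v = (u^T *m v) 0 0.
  by rewrite mxE; apply: eq_bigr => i _; rewrite mxE.
by rewrite !E trmx_mul mulmxA.
Qed.

Lemma dot_ge0 (R : realType) n (u : 'cV[R]_n) : 0 <= dot u u.
Proof. by apply: sumr_ge0 => i _; rewrite -expr2 sqr_ge0. Qed.

Lemma dot_eq0 (R : realType) n (u : 'cV[R]_n) : dot u u = 0 -> u = 0.
Proof.
move=> u0; apply/colP => i; rewrite mxE.
have /(_ i isT) /eqP := psumr_eq0P (fun i _ => sqr_ge0 (u i 0)) u0.
by rewrite mulf_eq0 orbb => /eqP.
Qed.

Lemma cauchy_schwarz (R : realType) n (u v : 'cV[R]_n) :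
  dot u v ^+ 2 <= dot u u * dot v v.
Proof.
have [v0|vn0] := eqVneq (dot v v) 0.
  by rewrite (dot_eq0 v0) dotC !dot0l mulr0 expr0n.
have vp : 0 < dot v v by rewrite lt_def vn0 dot_ge0.
have := dot_ge0 (dot v v *: u - dot u v *: v).
rewrite !dotE (dotC v u) => H.
rewrite -subr_ge0 -(pmulr_rge0 _ vp); apply: le_trans H _.
by rewrite le_eqVlt; apply/orP; left; apply/eqP; ring.
Qed.

Lemma cauchy_schwarz_sqrt (R : realType) n (u v : 'cV[R]_n) :
  dot u v <= Num.sqrt (dot u u) * Num.sqrt (dot v v).
Proof.
rewrite -sqrtrM ?dot_ge0// (le_trans (ler_norm _))// -sqrtr_sqr.
by rewrite ler_wsqrtr// cauchy_schwarz.
Qed.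

Lemma normr_entry (R : realType) m n (A : 'M[R]_(m, n)) i j : `|A i j| <= `|A|.
Proof.
rewrite [leRHS]/Num.Def.normr /= mx_normrE.
by apply/bigmax_geP; right => /=; exists (i, j).
Qed.

Lemma normr_le (R : realType) m n (A : 'M[R]_(m, n)) c : 0 <= c ->
  (forall i j, `|A i j| <= c) -> `|A| <= c.
Proof.
move=> c0 Ac; rewrite [leLHS]/Num.Def.normr /= mx_normrE.
by apply: bigmax_le => // -[i j] _ /=.
Qed.

Lemma norm_sqr_le_dot (R : realType) n (u : 'cV[R]_n) : `|u| ^+ 2 <= dot u u.
Proof.
have us : `|u| <= Num.sqrt (dot u u).
  apply: normr_le => [|i j]; first exact: sqrtr_ge0.
  rewrite (ord1 j) -sqrtr_sqr ler_wsqrtr// /dot (bigD1 i)//= expr2 lerDl.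
  by apply: sumr_ge0 => k _; rewrite -expr2 sqr_ge0.
by rewrite -(sqr_sqrtr (dot_ge0 u)) lerXn2r ?nnegrE ?sqrtr_ge0.
Qed.

Lemma mulmx_dot_bound (R : realType) m n (N : 'M[R]_(m, n)) :
  exists2 C, 0 <= C & forall x, dot (N *m x) (N *m x) <= C ^+ 2 * dot x x.
Proof.
pose F := \sum_i dot (row i N)^T (row i N)^T.
have F0 : 0 <= F by apply: sumr_ge0 => i _; exact: dot_ge0.
exists (Num.sqrt F) => [|x]; first exact: sqrtr_ge0.
rewrite sqr_sqrtr// /F mulr_suml; apply: ler_sum => i _.
rewrite -expr2; apply: le_trans (cauchy_schwarz _ _).
rewrite le_eqVlt; apply/orP; left; apply/eqP; congr (_ ^+ 2).
by rewrite mxE; apply: eq_bigr => j _; rewrite !mxE.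
Qed.

Section WeightedNorm.
Context {R : realType} {q n : nat} (S : 'M[R]_(q, n)).

Lemma wnorm_ge0 z : 0 <= wnorm S z. Proof. exact: sqrtr_ge0. Qed.

Lemma wnorm_sqr z : wnorm S z ^+ 2 = dot (S *m z) (S *m z).
Proof. by rewrite sqr_sqrtr// dot_ge0. Qed.

Lemma wnormZ a z : 0 <= a -> wnorm S (a *: z) = a * wnorm S z.
Proof.
move=> a0; rewrite /wnorm -scalemxAr !dotE mulrA -expr2 sqrtrM ?sqr_ge0//.
by rewrite sqrtr_sqr ger0_norm.
Qed.

Lemma wnorm_sqrZ a z : wnorm S (a *: z) ^+ 2 = a ^+ 2 * wnorm S z ^+ 2.
Proof. by rewrite !wnorm_sqr -scalemxAr !dotE; ring. Qed.

Lemma wnorm0 : wnorm S 0 = 0.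
Proof. by rewrite -(scale0r 0) wnormZ// mul0r. Qed.

Lemma wnorm_sqrC x y : wnorm S (x - y) ^+ 2 = wnorm S (y - x) ^+ 2.
Proof. by rewrite !wnorm_sqr !mulmxBr !dotE; ring. Qed.

Lemma wnorm_sqr_conv s x y w :
  wnorm S (s *: x + (1 - s) *: y - w) ^+ 2 =
  s * wnorm S (x - w) ^+ 2 + (1 - s) * wnorm S (y - w) ^+ 2
  - s * (1 - s) * wnorm S (x - y) ^+ 2.
Proof.
rewrite !wnorm_sqr !mulmxBr !mulmxDr -!scalemxAr !dotE.
rewrite (dotC (S *m y) (S *m x)) (dotC (S *m w) (S *m x)).
by rewrite (dotC (S *m w) (S *m y)); ring.
Qed.

Lemma wnorm_sqrB_le x y :
  wnorm S (x - y) ^+ 2 <= 2 * wnorm S x ^+ 2 + 2 * wnorm S y ^+ 2.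
Proof.
rewrite !wnorm_sqr; have := dot_ge0 (S *m x + S *m y).
by rewrite mulmxBr !dotE (dotC (S *m y) (S *m x)); lra.
Qed.

Context (S_posdef : posdef (S^T *m S)).

Lemma wnorm_eq0 z : wnorm S z = 0 -> z = 0.
Proof.
move=> z0; apply/eqP/negPn/negP => /S_posdef.
by rewrite -mulmxA -dot_mulmxl -wnorm_sqr z0 expr0n ltxx.
Qed.

Lemma wnorm_gt0 z : z != 0 -> 0 < wnorm S z.
Proof.
move=> zn0; rewrite lt_def wnorm_ge0 andbT; apply: contraNN zn0 => /eqP z0.
exact/eqP/wnorm_eq0.
Qed.

(** Positive definiteness makes [S] injective, so [S] has a left inverse [T];
    this turns bounds on [dot u z] into bounds by [S *m z], which is how the
    suprema defining dual and operator norms are seen to be bounded. *)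
Lemma posdef_left_inverse : exists T : 'M[R]_(n, q), T *m S = 1%:M.
Proof.
set G := S^T *m S.
have Gu : G \in unitmx.
  rewrite -row_free_unit -kermx_eq0; apply/rowV0P => v /sub_kermxP vG.
  have Gv : G *m v^T = 0.
    have GT : G^T = G by rewrite /G trmx_mul trmxK.
    by rewrite -GT -trmx_mul vG trmx0.
  have [//|vn0] := eqVneq v 0; have /S_posdef : v^T != 0 by rewrite trmx_eq0.
  by rewrite Gv dotC dot0l ltxx.
by exists (invmx G *m S^T); rewrite -mulmxA mulVmx.
Qed.

Lemma dot_le_wnorm_ex u : exists M, forall v, dot u v <= M * wnorm S v.
Proof.
have [T TS] := posdef_left_inverse.
exists (Num.sqrt (dot (T^T *m u) (T^T *m u))) => v.
have -> : dot u v = dot (T^T *m u) (S *m v).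
  by rewrite dot_mulmxl trmxK mulmxA TS mul1mx.
exact: cauchy_schwarz_sqrt.
Qed.

Lemma dot_le_dual_norm u v : dot u v <= dual_norm S u * wnorm S v.
Proof.
have [->|/wnorm_gt0 vp] := eqVneq v 0; first by rewrite wnorm0 dotC dot0l mulr0.
rewrite -ler_pdivrMr// mulrC -dotZr; apply: ub_le_sup.
  have [M uM] := dot_le_wnorm_ex u.
  by exists M => _ [w w1 <-]; rewrite (le_trans (uM w))// w1 mulr1.
exists ((wnorm S v)^-1 *: v) => //=.
by rewrite wnormZ ?invr_ge0 ?wnorm_ge0// mulVf ?gt_eqF.
Qed.

Lemma dual_norm_le u K : 0 <= K ->
  (forall v, dot u v <= K * wnorm S v) -> dual_norm S u <= K.
Proof.
move=> K0 uK; rewrite /dual_norm.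
have [->|/set0P ne] := eqVneq [set dot u v | v in [set v | wnorm S v = 1]] set0.
  by rewrite sup0.
by apply: ge_sup => // _ [v v1 <-]; rewrite (le_trans (uK v))// v1 mulr1.
Qed.

End WeightedNorm.

Lemma dual_norm_le_opnorm (R : realType) q r n m (SX : 'M[R]_(q, n))
    (SY : 'M[R]_(r, m)) (A : 'M[R]_(m, n)) x :
  posdef (SX^T *m SX) -> posdef (SY^T *m SY) ->
  dual_norm SY (A *m x) <= opnorm SX SY A * wnorm SX x.
Proof.
move=> pX pY; have [->|xn0] := eqVneq x 0.
  rewrite wnorm0 mulr0 mulmx0; apply: dual_norm_le => // v.
  by rewrite dot0l mul0r.
have xp := wnorm_gt0 pX xn0.
rewrite -ler_pdivrMr//; apply: ub_le_sup; last by exists x.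
have [T TS] := posdef_left_inverse pX.
have [U US] := posdef_left_inverse pY.
have [C C0 NC] := mulmx_dot_bound (U^T *m (A *m T)).
exists C => _ [z zn0 <-].
have zp := wnorm_gt0 pX zn0.
rewrite ler_pdivrMr//; apply: dual_norm_le => [|v].
  by rewrite mulr_ge0 ?wnorm_ge0.
have -> : dot (A *m z) v = dot (U^T *m (A *m T) *m (SX *m z)) (SY *m v).
  rewrite -mulmxA [RHS]dot_mulmxl trmxK (mulmxA U) US mul1mx.
  by rewrite -mulmxA (mulmxA T) TS mul1mx.
apply: le_trans (cauchy_schwarz_sqrt _ _) _.
rewrite ler_wpM2r ?sqrtr_ge0//.
have -> : C * wnorm SX z = Num.sqrt (C ^+ 2 * dot (SX *m z) (SX *m z)).
  by rewrite sqrtrM ?sqr_ge0// sqrtr_sqr ger0_norm.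
by rewrite ler_wsqrtr.
Qed.

(** * Minimizers of strongly convex functions *)

Lemma le_of_small_multiples (R : realFieldType) (a b : R) :
  (forall s, 0 < s < 1 -> (1 - s) * a <= b) -> a <= b.
Proof.
move=> H; rewrite leNgt; apply/negP => ba.
pose d := a - b; have d0 : 0 < d by rewrite subr_gt0.
have D0 : 0 < 2 * (`|a| + d) by rewrite mulr_gt0// ltr_wpDl.
pose s := d / (2 * (`|a| + d)).
have s0 : 0 < s by rewrite divr_gt0.
have s1 : s < 1 by rewrite ltr_pdivrMr// mul1r; have := normr_ge0 a; lra.
have sa : s * a < d.
  apply: (@le_lt_trans _ _ (s * `|a|)); first by rewrite ler_pM2l// ler_norm.
  rewrite mulrAC ltr_pdivrMr// ltr_pM2l//; have := normr_ge0 a; lra.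
by have := H s; rewrite s0 s1 => /(_ isT); move: sa; rewrite /d; lra.
Qed.

(** Comparing the minimizer [x] with the points of the segment towards [z] and
    letting [s] tend to 0 turns strong convexity into a gain [kappa].  Only the
    segment is involved, so [phi] may be the finite part of an extended-valued
    function whose effective domain contains it. *)
Lemma minimizer_growth (R : realFieldType) (V : lmodType R) (phi : V -> R)
    (x z : V) (kappa : R) :
  (forall s, 0 < s < 1 -> phi x <= phi (s *: z + (1 - s) *: x)) ->
  (forall s, 0 < s < 1 ->
     phi (s *: z + (1 - s) *: x) + s * (1 - s) * kappa
     <= s * phi z + (1 - s) * phi x) ->
  phi x + kappa <= phi z.
Proof.
move=> xmin conv; rewrite addrC -lerBrDr.
apply: le_of_small_multiples => s s01; have /andP[s0 _] := s01.
rewrite -(ler_pM2l s0) mulrA; have := xmin s s01; have := conv s s01.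
by rewrite mulrBr; lra.
Qed.

(** * Finite convex Lipschitz functions and their conjugates *)

Lemma lipschitz_bound (R : realType) m (G : 'cV[R]_m -> R) : lipschitz G ->
  exists2 K, 0 <= K & forall u v, `|G u - G v| <= K * `|u - v|.
Proof.
move=> /(@pinfty_ex_gt0 _ _) [K K0 /= GK].
by exists K => [|u v]; [exact: ltW | exact: (GK (u, v))].
Qed.

Lemma trmx_norm (R : realType) m n (A : 'M[R]_(m, n)) : `|A^T| = `|A|.
Proof.
apply/eqP; rewrite eq_le; apply/andP; split; apply: normr_le => // i j.
  by rewrite mxE normr_entry.
by have := normr_entry A^T j i; rewrite mxE.
Qed.

(** Beyond distance [2 t K] from [u0] the quadratic exceeds any decrease of [G],
    so it suffices to minimize over a compact ball. *)
Lemma lipschitz_quadratic_minimizer (R : realType) m (G : 'cV[R]_m -> R)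
    (K t : R) (u0 : 'cV[R]_m) :
  0 <= K -> 0 < t -> (forall u v, `|G u - G v| <= K * `|u - v|) ->
  exists z, forall u,
    G z + (2 * t)^-1 * dot (z - u0) (z - u0)
    <= G u + (2 * t)^-1 * dot (u - u0) (u - u0).
Proof.
move=> K0 t0 GK.
pose phi (v : 'rV[R]_m) := G v^T + (2 * t)^-1 * dot (v^T - u0) (v^T - u0).
pose r := 2 * t * K.
have r0 : 0 <= r by rewrite /r !mulr_ge0// ltW.
(* Compactness is that of closed bounded sets of row vectors, hence the
   transposes. *)
pose B := closed_ball_ Num.norm u0^T r.
have B0 : B !=set0 by exists u0^T; rewrite /B/closed_ball_/= subrr normr0.
have cB : compact B.
  apply: bounded_closed_compact; last exact: closed_closed_ball_.
  exists (`|u0^T| + r); split; first exact: num_real.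
  move=> M HM v /= vB; apply: le_trans (ltW HM).
  have := ler_normB u0^T (u0^T - v); rewrite opprB addrC subrK.
  by move: vB; rewrite /B /closed_ball_ /=; lra.
have cphi : continuous phi.
  have cG : continuous (fun v : 'rV[R]_m => G v^T).
    move=> v; apply/(@cvgrPdist_le _ _ _ (nbhs v)) => e e0.
    near=> w; apply: le_trans (GK _ _) _.
    rewrite -linearB/= trmx_norm.
    apply: (@le_trans _ _ ((K + 1) * `|v - w|)).
      by rewrite ler_wpM2r// lerDl.
    rewrite -ler_pdivlMl; last by rewrite ltr_wpDl.
    near: w; apply: cvgr_dist_le; first exact: cvg_id.
    by rewrite mulr_gt0// invr_gt0 ltr_wpDl.
  move=> v; apply: (cvgD (cG v)).
  apply: cvgMr; apply: cvg_big => [|i _].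
    by move=> x; exact: add_continuous.
  have cc : (w^T - u0) i 0 @[w --> v] --> (v^T - u0) i 0.
    have -> : (fun w : 'rV[R]_m => (w^T - u0) i 0) = (fun w => w 0 i - u0 i 0).
      by apply/funext => w; rewrite !mxE.
    have -> : (v^T - u0) i 0 = v 0 i - u0 i 0 by rewrite !mxE.
    have cv : (fun w : 'rV[R]_m => w 0 i) w @[w --> v] --> v 0 i.
      exact: coord_continuous.
    by apply: (cvgB cv); exact: cvg_cst.
  exact: cvgM.
have [z _ zmin] := compact_EVT_min B0 cB (continuous_subspaceT cphi).
exists z^T => u.
have [uB|uB] := lerP `|u0 - u| r.
  have := zmin u^T; rewrite /phi trmxK; apply.
  by rewrite inE /B /closed_ball_ /= -linearB/= trmx_norm.
have /= H0 := zmin u0^T; rewrite /phi trmxK subrr dot0l mulr0 addr0 in H0.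
apply: le_trans (H0 _) _.
  by rewrite inE /B/closed_ball_/= subrr normr0.
have GG : G u0 - G u <= K * `|u0 - u| by apply: le_trans (ler_norm _) (GK _ _).
have t2 : 0 < 2 * t by rewrite mulr_gt0.
have nd : K * `|u0 - u| <= (2 * t)^-1 * dot (u - u0) (u - u0).
  rewrite [leRHS]mulrC ler_pdivlMr//; apply: le_trans (norm_sqr_le_dot _).
  by rewrite (distrC u) expr2 mulrAC ler_wpM2r// mulrC ltW.
by lra.
Unshelve. all: by end_near.
Qed.

(** Half of the Fenchel-Moreau theorem, up to an arbitrarily small error.  If
    [z] minimizes [G u + |u - u0|^2 / (2 t)], then strong convexity of the
    quadratic term turns minimality into the subgradient inequality of [G] at
    [z] with slope [(u0 - z) / t]; the Lipschitz property forces [z] to lie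
    within [2 t K] of [u0], so this affine minorant is nearly exact at [u0]. *)
Lemma affine_minorant_approx (R : realType) m (G : 'cV[R]_m -> R)
    (K e : R) (u0 : 'cV[R]_m) :
  0 <= K -> 0 < e -> (forall u v, `|G u - G v| <= K * `|u - v|) ->
  (forall u v s, 0 < s < 1 ->
     G (s *: u + (1 - s) *: v) <= s * G u + (1 - s) * G v) ->
  exists y c, (forall u, dot u y - G u <= c) /\ G u0 - e <= dot u0 y - c.
Proof.
move=> K0 e0 GK Gconv.
(* The minorant misses [G u0] by at most [2 t K ^+ 2]. *)
pose t := e / (2 * (K ^+ 2 + 1)).
have K1 : 0 < 2 * (K ^+ 2 + 1) by rewrite mulr_gt0// ltr_wpDl// sqr_ge0.
have t0 : 0 < t by rewrite divr_gt0.
have tK : 2 * t * K ^+ 2 <= e.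
  have : t * (2 * (K ^+ 2 + 1)) = e by rewrite /t mulfVK ?gt_eqF.
  by have := ltW t0; lra.
have [z zmin] := lipschitz_quadratic_minimizer u0 K0 t0 GK.
have sub u : G z + t^-1 * dot (u - z) (u0 - z) <= G u.
  pose phi w := G w + (2 * t)^-1 * dot (w - u0) (w - u0).
  have conv s : dot (s *: u + (1 - s) *: z - u0) (s *: u + (1 - s) *: z - u0) =
      s * dot (u - u0) (u - u0) + (1 - s) * dot (z - u0) (z - u0)
      - s * (1 - s) * dot (u - z) (u - z).
    by rewrite !dotE (dotC z u) (dotC u0 u) (dotC u0 z); ring.
  have growth : phi z + (2 * t)^-1 * dot (u - z) (u - z) <= phi u.
    apply: minimizer_growth => [s _|s s01]; first exact: zmin.
    by rewrite /phi conv; have := Gconv u z s s01; lra.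
  have three_points : dot (u - u0) (u - u0) = dot (z - u0) (z - u0)
      + dot (u - z) (u - z) - 2 * dot (u - z) (u0 - z).
    by rewrite !dotE (dotC z u) (dotC u0 u) (dotC u0 z); ring.
  have -> : t^-1 = 2 * (2 * t)^-1 by field; rewrite gt_eqF.
  by move: growth; rewrite /phi three_points; lra.
exists (t^-1 *: (u0 - z)), (t^-1 * dot z (u0 - z) - G z); split.
  by move=> u; have := sub u; rewrite !dotE; lra.
have dz : dot (z - u0) (z - u0) = dot (u0 - z) (u0 - z).
  by rewrite !dotE; ring.
have Gz : G u0 - G z <= K * `|u0 - z| := le_trans (ler_norm _) (GK _ _).
have near : `|u0 - z| <= 2 * t * K.
  have := zmin u0; rewrite subrr dot0l mulr0 addr0 dz => H.
  have t2 : 0 < 2 * t by rewrite mulr_gt0.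
  have : (2 * t)^-1 * dot (u0 - z) (u0 - z) <= K * `|u0 - z| by lra.
  rewrite mulrC ler_pdivrMr// => H2.
  have := le_trans (norm_sqr_le_dot _) H2.
  have [->|n0] := eqVneq (u0 - z) 0; first by rewrite normr0 mulr_ge0// ltW.
  have np : 0 < `|u0 - z| by rewrite normr_gt0.
  by rewrite expr2 mulrAC ler_pM2r// mulrC.
have q0 : 0 <= t^-1 * dot (u0 - z) (u0 - z).
  by rewrite mulr_ge0 ?dot_ge0 ?invr_ge0// ltW.
have KK := ler_wpM2l K0 near.
move: q0; rewrite (dotDl u0) dotNl dotZr; lra.
Qed.

Section Conjugate.
Context {R : realType} {m : nat} (g : 'cV[R]_m -> \bar R).
Context (g_fin : forall u, g u \is a fin_num).
Local Notation G := (fine \o g).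
Local Notation h := (fine \o fconj g).

Lemma fconj_ge u y : ((dot u y - G u)%:E <= fconj g y)%E.
Proof.
by apply: ereal_sup_ubound; exists u; rewrite // -[in LHS](fineK (g_fin u)).
Qed.

Lemma fconj_le y c : (forall u, dot u y - G u <= c) -> (fconj g y <= c%:E)%E.
Proof.
move=> H; apply: ge_ereal_sup => _ [u _ <-].
by rewrite -(fineK (g_fin u)) -EFinB lee_fin; exact: H.
Qed.

Lemma fconj_fin y : dom (fconj g) y -> fconj g y \is a fin_num.
Proof.
move=> ylt; rewrite fin_numE (lt_eqF ylt) andbT gt_eqF//.
by apply: lt_le_trans (fconj_ge 0 y); rewrite ltNyr.
Qed.

Lemma fenchel_young u y : dom (fconj g) y -> dot u y - G u <= h y.
Proof. by move=> /fconj_fin yfin; rewrite -lee_fin fineK// fconj_ge. Qed.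

Lemma fconj_finite_le y c : (forall u, dot u y - G u <= c) ->
  dom (fconj g) y /\ h y <= c.
Proof.
move=> /fconj_le yc; have ydom : dom (fconj g) y := le_lt_trans yc (ltry c).
by split=> //; rewrite -lee_fin fineK// fconj_fin.
Qed.

Lemma fconj_convex y z s : 0 < s < 1 ->
  dom (fconj g) y -> dom (fconj g) z ->
  dom (fconj g) (s *: y + (1 - s) *: z) /\
  h (s *: y + (1 - s) *: z) <= s * h y + (1 - s) * h z.
Proof.
move=> /andP[s0 s1] ydom zdom; apply: fconj_finite_le => u.
have H1 : s * (dot u y - G u) <= s * h y by rewrite ler_pM2l// fenchel_young.
have H2 : (1 - s) * (dot u z - G u) <= (1 - s) * h z.
  by rewrite ler_pM2l ?subr_gt0// fenchel_young.
by rewrite !dotE; lra.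
Qed.

(** Testing Fenchel-Young along the ray through [y] itself gives
    [s * dot y y <= s * K * |y| + O(1)] for all [s > 0]. *)
Lemma dom_fconj_bounded K : 0 <= K ->
  (forall u v, `|G u - G v| <= K * `|u - v|) ->
  forall y, dom (fconj g) y -> dot y y <= K ^+ 2.
Proof.
move=> K0 GK y ydom.
pose c := h y + G 0.
have ray t : 0 < t -> t * (dot y y - K * `|y|) <= c.
  move=> t0; have := fenchel_young (t *: y) ydom; rewrite dotZl.
  have := le_trans (ler_norm _) (GK (t *: y) 0).
  by rewrite subr0 normrZ gtr0_norm// /c; lra.
have yy : dot y y <= K * `|y|.
  rewrite -subr_le0 leNgt; apply/negP => d0.
  have t0 : 0 < (`|c| + 1) / (dot y y - K * `|y|).
    by rewrite divr_gt0// ltr_wpDl.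
  have := ray _ t0; rewrite mulfVK ?gt_eqF//; have := ler_norm c; lra.
have yK : `|y| <= K.
  have [->|n0] := eqVneq y 0; first by rewrite normr0.
  have np : 0 < `|y| by rewrite normr_gt0.
  by rewrite -(ler_pM2r np) -expr2 (le_trans (norm_sqr_le_dot y)).
by rewrite (le_trans yy)// expr2 ler_wpM2l.
Qed.

End Conjugate.

(** * Prox-functions *)

Section ProxFunction.
Context {R : realType} {r m : nat} (S : 'M[R]_(r, m)).
Context (p : 'cV[R]_m -> \bar R) (gradp : 'cV[R]_m -> 'cV[R]_m) (Lb : R).
Context (S_posdef : posdef (S^T *m S)).
Context (p_prox : prox_function S p gradp Lb).
Local Notation P := (fine \o p).

Lemma prox_fin y : dom p y -> p y \is a fin_num.
Proof.
by move=> ydom; rewrite fin_numE (prox_proper p_prox).1 (lt_eqF ydom).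
Qed.

Lemma prox_strong_convexity x y s : 0 < s < 1 -> dom p x -> dom p y ->
  dom p (s *: x + (1 - s) *: y) /\
  P (s *: x + (1 - s) *: y) + s * (1 - s) * (2^-1 * wnorm S (x - y) ^+ 2)
  <= s * P x + (1 - s) * P y.
Proof.
move=> s01 xdom ydom; have := prox_strongly_convex p_prox x y s01.
rewrite -(fineK (prox_fin xdom)) -(fineK (prox_fin ydom)) -!EFinM -EFinD => H.
have mdom : dom p (s *: x + (1 - s) *: y).
  rewrite /dom /= ltey; apply/eqP => E; move: H; rewrite E addye//.
split => //; move: H; rewrite -(fineK (prox_fin mdom)) -EFinD lee_fin /=.
by lra.
Qed.

(** Strong convexity bounds the increment of [p] from [y] to [y + s *: d] by
    [s] times the increment to [z = y + d], up to the quadratic gain; the gradient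
    gives the same increment to first order, and [s] tends to 0.  All points
    compared lie in [dom p], so a gradient relative to [dom p] suffices. *)
Lemma prox_gradient_ineq y z : dom p y -> dom p z ->
  P y + dot (gradp y) (z - y) + 2^-1 * wnorm S (z - y) ^+ 2 <= P z.
Proof.
move=> ydom zdom; apply/ler_addgt0Pr => e e0.
set d := z - y; set N := 2^-1 * _.
have N0 : 0 <= N by rewrite mulr_ge0 ?sqr_ge0.
pose eps := e / (2 * (`|d| + 1)).
have D0 : 0 < 2 * (`|d| + 1) by rewrite mulr_gt0// ltr_wpDl.
have eps0 : 0 < eps by rewrite divr_gt0.
have epsd : eps * `|d| <= e / 2.
  rewrite /eps mulrAC ler_pdivrMr// -mulrA (ler_pM2l e0).
  by have := normr_ge0 d; lra.
have cvy : y + s *: d @[s --> 0^'+] --> y.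
  rewrite -[X in _ --> X]addr0 -(scale0r d); apply: cvgD; first exact: cvg_cst.
  apply: cvgZl; apply: cvg_at_right_filter; exact: cvg_id.
have /cvy /= H := prox_gradient p_prox ydom eps0.
have : \forall s \near 0^'+, [/\ 0 < s, s < 1, s * N <= e / 2 &
    dom p (y + s *: d) ->
      `|P (y + s *: d) - P y - dot (gradp y) (y + s *: d - y)|
      <= eps * `|y + s *: d - y| ].
  near=> s; split.
  - by near: s; exact: nbhs_right_gt.
  - by near: s; exact: nbhs_right_lt.
  - apply: (@le_trans _ _ (s * (N + 1))).
      by rewrite ler_wpM2l ?lerDl//; near: s; exact: nbhs_right_ge.
    rewrite -ler_pdivlMr; last by rewrite ltr_wpDl.
    near: s; apply: nbhs_right_le.
    by rewrite !divr_gt0// ltr_wpDl.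
  - by near: s; exact: H.
move=> /filter_ex [s [s0 s1 sN Hs]].
have s01 : 0 < s < 1 by rewrite s0 s1.
have [mdom] := prox_strong_convexity s01 zdom ydom.
have mE : s *: z + (1 - s) *: y = y + s *: d.
  by rewrite /d scalerBl scale1r scalerBr addrCA addrA.
rewrite mE in mdom *; rewrite -/N -/d => conv.
have := Hs mdom; rewrite (addrAC y) subrr add0r normrZ gtr0_norm//.
rewrite dotZr ler_norml.
move=> /andP[grad _].
have ds : s * (eps * `|d|) <= s * (e / 2) by rewrite ler_pM2l.
have ss : s * (s * N) <= s * (e / 2) by rewrite ler_pM2l.
rewrite -(ler_pM2l s0); move: grad conv; rewrite /=; lra.
Unshelve. all: by end_near.
Qed.

Lemma bregmanE y yc : dom p y -> dom p yc ->
  bregman p gradp y yc = (P y - P yc - dot (gradp yc) (y - yc))%:E.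
Proof.
move=> ydom ycdom; rewrite /bregman.
by rewrite -(fineK (prox_fin ydom)) -(fineK (prox_fin ycdom)).
Qed.

Lemma bregman_ge0 y yc : dom p y -> dom p yc -> (0 <= bregman p gradp y yc)%E.
Proof.
move=> ydom ycdom; rewrite bregmanE// lee_fin.
have := prox_gradient_ineq ycdom ydom.
by have := sqr_ge0 (wnorm S (y - yc)); rewrite /=; lra.
Qed.

(** Adding the gradient inequality at [y] to the definition of the Bregman
    distance leaves [dot (gradp y - gradp yc) (y - yc)], to which the Lipschitz
    bound on the gradient applies. *)
Lemma bregman_le y yc : dom p y -> dom p yc ->
  (bregman p gradp y yc <= (Lb * wnorm S (y - yc) ^+ 2)%:E)%E.
Proof.
move=> ydom ycdom; rewrite bregmanE// lee_fin.
have grad := prox_gradient_ineq ydom ycdom.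
have lip := prox_lipschitz_gradient p_prox ydom ycdom.
have dual := dot_le_dual_norm S_posdef (gradp y - gradp yc) (y - yc).
have {lip} := ler_wpM2r (wnorm_ge0 S (y - yc)) lip; rewrite -mulrA -expr2.
move: grad dual; have := sqr_ge0 (wnorm S (yc - y)).
rewrite !dotE /=; lra.
Qed.

End ProxFunction.

Lemma dual_diameter_finite (R : realType) r m (S : 'M[R]_(r, m))
    (g p : 'cV[R]_m -> \bar R) gradp Lb yc :
  posdef (S^T *m S) -> prox_function S p gradp Lb -> 0 <= Lb -> dom p yc ->
  dom (fconj g) `<=` dom p ->
  (forall u, g u \is a fin_num) -> lipschitz (fine \o g) ->
  (dual_diameter g p gradp yc < +oo)%E.
Proof.
move=> pS p_prox Lb0 ycdom domgp g_fin.
move=> /lipschitz_bound [K K0 GK].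
have [C C0 SC] := mulmx_dot_bound S.
pose B := Lb * (2 * (C ^+ 2 * K ^+ 2) + 2 * wnorm S yc ^+ 2).
apply: (@le_lt_trans _ _ B%:E); last exact: ltry.
apply: ge_ereal_sup => _ [y ydom <-].
apply: le_trans (bregman_le pS p_prox (domgp _ ydom) ycdom) _.
rewrite lee_fin ler_wpM2l// (le_trans (wnorm_sqrB_le _ _ _))// lerD2r.
rewrite ler_pM2l// wnorm_sqr (le_trans (SC y))// ler_wpM2l ?sqr_ge0//.
exact: (dom_fconj_bounded g_fin K0 GK).
Qed.

(** * Step sizes and smoothness parameters *)

Section StepSizes.
Context {R : realFieldType} (tau beta : nat -> R).
Context (tau0 : tau 0 = 1).
Context (tau_bounds : forall k, 0 < tau k.+1 < 1).
Context (tau_root : forall k,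
  tau k.+1 ^+ 3 + tau k.+1 ^+ 2 + tau k ^+ 2 * tau k.+1 - tau k ^+ 2 = 0).
Context (beta1_gt0 : 0 < beta 1).
Context (betaS : forall k, beta k.+2 = beta k.+1 / (1 + tau k.+1)).

Lemma tau_gt0 k : 0 < tau k.
Proof. by case: k => [|k]; [rewrite tau0 | case/andP: (tau_bounds k)]. Qed.

Lemma tau_le1 k : tau k <= 1.
Proof.
by case: k => [|k]; [rewrite tau0 | case/andP: (tau_bounds k) => _ /ltW].
Qed.

Lemma beta_gt0 k : 0 < beta k.+1.
Proof. by elim: k => // k IH; rewrite betaS divr_gt0// addr_gt0// tau_gt0. Qed.

(** The cubic polynomial is increasing in [tau k.+1], so it suffices that it is
    nonpositive at [1 / (k + 2)] when [tau k >= 1 / (k + 1)], which amounts to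
    [(k + 1) * (k + 3) <= (k + 2) ^ 2]. *)
Lemma tau_ge k : k.+1%:R^-1 <= tau k.
Proof.
elim: k => [|k IH]; first by rewrite tau0 invr1.
rewrite leNgt; apply/negP; have t0 := tau_gt0 k.+1.
set t := tau k.+1 in t0 *; set b := k.+2%:R^-1; set a := k.+1%:R^-1 in IH.
move=> tb.
have N0 : 0 < k.+1%:R :> R by rewrite ltr0n.
have a0 : 0 < a by rewrite invr_gt0.
have b0 : 0 < b by rewrite invr_gt0 ltr0n.
have ab : b ^+ 2 * (1 + b) <= a ^+ 2 * (1 - b).
  rewrite -subr_ge0 /a /b -(natr1 k.+1); set N := k.+1%:R in N0 *.
  have -> : N^-1 ^+ 2 * (1 - (N + 1)^-1) - (N + 1)^-1 ^+ 2 * (1 + (N + 1)^-1)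
     = (N * (N + 1) ^+ 3)^-1.
    by field; rewrite !gt_eqF// addr_gt0.
  by rewrite invr_ge0 mulr_ge0 ?exprn_ge0 ?addr_ge0// ltW.
have b1 : b <= 1 by rewrite invf_le1 ?ltr0n// ler1n.
have ta : a ^+ 2 * (1 - b) <= tau k ^+ 2 * (1 - t).
  apply: ler_pM; rewrite ?exprn_ge0 ?subr_ge0 ?(ltW a0)//.
    by rewrite lerXn2r ?nnegrE ?(ltW a0) ?(ltW (tau_gt0 k)).
  by rewrite lerD2l lerN2 ltW.
have tb2 : t ^+ 2 * (1 + t) < b ^+ 2 * (1 + b).
  apply: ltr_pM; rewrite ?exprn_ge0 ?addr_ge0 ?(ltW t0)//.
    by rewrite ltrXn2r ?nnegrE ?(ltW b0) ?(ltW t0).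
  by rewrite ltrD2l.
by have := tau_root k; rewrite -/t; lra.
Qed.

Lemma beta_le k : beta k.+1 <= 2 * beta 1 / k.+2%:R.
Proof.
elim: k => [|k IH].
  by rewrite mulrAC divff ?mul1r// pnatr_eq0.
rewrite betaS ler_pdivrMr ?addr_gt0 ?tau_gt0//.
apply: (le_trans IH); have := tau_ge k.+1.
have N0 : 0 < k.+2%:R :> R by rewrite ltr0n.
rewrite -(natr1 k.+2); set N := k.+2%:R in N0 *; move=> tN.
have N1 : 0 < N + 1 by rewrite addr_gt0.
apply: (@le_trans _ _ (2 * beta 1 / (N + 1) * (1 + N^-1))).
  rewrite le_eqVlt; apply/orP; left; apply/eqP.
  by field; rewrite !gt_eqF.
by rewrite ler_wpM2l ?lerD2l// divr_ge0 ?mulr_ge0// ltW.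
Qed.

(** This is the cubic equation for [tau k.+1], rewritten so that the recursion
    for the gap, whose contraction factor is [1 - tau k.+1], telescopes. *)
Lemma tau_beta_telescope k :
  tau k.+1 ^+ 2 / beta k.+2 = (1 - tau k.+1) * (tau k ^+ 2 / beta k.+1).
Proof.
have := tau_root k; rewrite betaS; set t := tau k.+1 => root.
have t1 : 0 < 1 + t by rewrite addr_gt0 ?tau_gt0.
have -> : t ^+ 2 / (beta k.+1 / (1 + t)) = t ^+ 2 * (1 + t) / beta k.+1.
  by field; rewrite !gt_eqF ?beta_gt0.
rewrite mulrA; congr (_ / _); lra.
Qed.

Lemma tau_beta_le k : tau k ^+ 2 / beta k.+1 <= (beta 1 * k.+1%:R)^-1.
Proof.
elim: k => [|k IH]; first by rewrite tau0 expr1n mul1r mulr1.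
rewrite tau_beta_telescope; have := tau_ge k.+1.
have N0 : 0 < k.+1%:R :> R by rewrite ltr0n.
rewrite -(natr1 k.+1) in IH *; set N := k.+1%:R in N0 IH *; move=> tN.
have N1 : 0 < N + 1 by rewrite addr_gt0.
have -> : (beta 1 * (N + 1))^-1 = (1 - (N + 1)^-1) * (beta 1 * N)^-1.
  by field; rewrite !gt_eqF.
apply: ler_pM; rewrite ?subr_ge0 ?tau_le1//.
  by rewrite divr_ge0 ?exprn_ge0// ltW ?tau_gt0 ?beta_gt0.
by rewrite lerD2l lerN2.
Qed.

End StepSizes.

Lemma asgard_parameters (R : realType) q r n m (SX : 'M[R]_(q, n))
    (SY : 'M[R]_(r, m)) f g (A : 'M[R]_(m, n)) p gradp yc beta1
    tau beta xbar xhat ystar :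
  asgard SX SY f g A p gradp 1 yc beta1 tau beta xbar xhat ystar ->
  [/\ tau 0 = 1, forall k, 0 < tau k.+1 < 1,
      forall k, tau k.+1 ^+ 3 + tau k.+1 ^+ 2 + tau k ^+ 2 * tau k.+1
                - tau k ^+ 2 = 0 &
      forall k, beta k.+2 = beta k.+1 / (1 + tau k.+1)].
Proof.
move=> alg; split=> [|k|k|k].
- exact: asgard_tau0 alg.
- exact: (asgard_tau_bounds alg k).
- by have := asgard_tau_root alg k; rewrite divr1.
- by rewrite (asgard_beta alg) invr1 mul1r.
Qed.

(** * Convergence of the primal-dual smoothing iteration *)

Lemma potential_decrease (R : realDomainType) (t v l0 l1 l2 n0 n1 n2 : R) :
  l2 + n2 <= l1 + n1 -> l1 <= t * v + (1 - t) * l0 ->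
  (1 - t) * (l0 - v) + n1 <= n0 -> l2 - v + n2 <= n0.
Proof. by lra. Qed.

Section Convergence.
Context {R : realType} {n m q r : nat}.
Context (f : 'cV[R]_n -> \bar R) (g : 'cV[R]_m -> \bar R) (A : 'M[R]_(m, n)).
Context (SX : 'M[R]_(q, n)) (SY : 'M[R]_(r, m)).
Context (p : 'cV[R]_m -> \bar R) (gradp : 'cV[R]_m -> 'cV[R]_m) (yc : 'cV[R]_m).
Context (f_proper : proper_efun f).
Context (f_convex : econvex f).
Context (g_fin : forall u, g u \is a fin_num).
Context (SX_posdef : posdef (SX^T *m SX)).
Context (SY_posdef : posdef (SY^T *m SY)).
Context (Lb : R).
Context (p_prox : prox_function SY p gradp Lb).
Context (p_dom : closure (dom (fconj g)) `<=` dom p).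
Context (ycdom : dom p yc).

Local Notation F := (fine \o f).
Local Notation G := (fine \o g).
Local Notation h := (fine \o fconj g).
Local Notation L := (LA SX SY A).
Local Notation breg y := (fine (bregman p gradp y yc)).

(** Its supremum over [y] in [dom (fconj g)] is the smoothed primal objective. *)
Definition smoothed_lagrangian (b : R) (x : 'cV[R]_n) (y : 'cV[R]_m) : R :=
  F x + (dot (A *m x) y - h y - b * breg y).
Local Notation lag := smoothed_lagrangian.

Lemma dom_fconj_prox y : dom (fconj g) y -> dom p y.
Proof. by move=> ydom; apply/p_dom/subset_closure. Qed.

Lemma bregman_fin y : dom p y -> bregman p gradp y yc \is a fin_num.
Proof. by move=> ydom; rewrite (bregmanE p_prox). Qed.

Lemma breg_ge0 y : dom (fconj g) y -> 0 <= breg y.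
Proof. by move=> /dom_fconj_prox ydom; apply/fine_ge0/(bregman_ge0 p_prox). Qed.

Lemma f_fin x : dom f x -> f x \is a fin_num.
Proof. by move=> xdom; rewrite fin_numE f_proper.1 (lt_eqF xdom). Qed.

Lemma f_convex_real x y s : 0 < s < 1 -> dom f x -> dom f y ->
  dom f (s *: x + (1 - s) *: y) /\
  F (s *: x + (1 - s) *: y) <= s * F x + (1 - s) * F y.
Proof.
move=> s01 xdom ydom; have := f_convex x y s01.
rewrite -(fineK (f_fin xdom)) -(fineK (f_fin ydom)) -!EFinM -EFinD => H.
have mdom : dom f (s *: x + (1 - s) *: y) := le_lt_trans H (ltry _).
by split => //; rewrite -lee_fin fineK// f_fin.
Qed.

Lemma breg_strong_convexity x y s : 0 < s < 1 ->
  dom (fconj g) x -> dom (fconj g) y ->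
  breg (s *: x + (1 - s) *: y) + s * (1 - s) * (2^-1 * wnorm SY (x - y) ^+ 2)
  <= s * breg x + (1 - s) * breg y.
Proof.
move=> s01 /dom_fconj_prox xdom /dom_fconj_prox ydom.
have [mdom] := prox_strong_convexity p_prox s01 xdom ydom.
by rewrite !(bregmanE p_prox)// !dotE /=; lra.
Qed.

Section Iteration.
Context (b : R) (u : 'cV[R]_n) (y : 'cV[R]_m) (x1 : 'cV[R]_n).
Context (b_gt0 : 0 < b).
Context (y_argmax : is_argmax (closure (dom (fconj g)))
  (fun y => (dot (A *m u) y)%:E - fconj g y - b%:E * bregman p gradp y yc)%E y).
Context (x1_argmin : is_argmin setT
  (fun x => f x + (dot (A^T *m y) (x - u))%:E
            + (L / (2 * b) * wnorm SX (x - u) ^+ 2)%:E)%E x1).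

Lemma dual_objective z : dom (fconj g) z ->
  ((dot (A *m u) z)%:E - fconj g z - b%:E * bregman p gradp z yc)%E =
  (dot (A *m u) z - h z - b * breg z)%:E.
Proof.
move=> zdom; rewrite -[in LHS](fineK (fconj_fin g_fin zdom)).
by rewrite -[in LHS](fineK (bregman_fin (dom_fconj_prox zdom))).
Qed.

(** The maximization runs over the closure of [dom (fconj g)], but the value at a
    point outside the domain is [-oo]. *)
Lemma argmax_dom : dom (fconj g) y.
Proof.
have [ycl ymax] := y_argmax.
have [z [zdom _]] : (dom (fconj g) `&` setT) !=set0 by exact: ycl filterT.
have := ymax z (subset_closure zdom); rewrite (dual_objective zdom).
rewrite -(fineK (bregman_fin (p_dom ycl))) -EFinM.
by rewrite /dom /= ltey; apply: contraPneq => ->; rewrite /= leNgt ltNyr.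
Qed.

(** Strong convexity of the Bregman term gives quadratic growth of the dual
    objective away from its maximizer, and the quadratic absorbs the effect of
    replacing [A *m u] by [A *m x]: this is the smoothness with constant [1 / b]
    of the regularized conjugate. *)
Lemma dual_step x z : dom (fconj g) z ->
  dot (A *m x) z - h z - b * breg z
  <= dot (A *m x) y - h y - b * breg y + L / (2 * b) * wnorm SX (x - u) ^+ 2.
Proof.
move=> zdom; have ydom := argmax_dom.
pose phi w := h w + b * breg w - dot (A *m u) w.
have growth : phi y + b * (2^-1 * wnorm SY (z - y) ^+ 2) <= phi z.
  apply: minimizer_growth => s s01.
    have [mdom _] := fconj_convex g_fin s01 zdom ydom.
    have := y_argmax.2 _ (subset_closure mdom).
    by rewrite !dual_objective// lee_fin /phi; lra.
  have [mdom] := fconj_convex g_fin s01 zdom ydom.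
  have := breg_strong_convexity s01 zdom ydom.
  rewrite -(ler_pM2l b_gt0) /phi !dotE; lra.
have dual := dot_le_dual_norm SY_posdef (A *m (x - u)) (z - y).
have op := ler_wpM2r (wnorm_ge0 SY (z - y))
  (dual_norm_le_opnorm A (x - u) SX_posdef SY_posdef).
set a := wnorm SX (x - u) in op *.
set N := wnorm SY (z - y) in op dual growth *.
set l := opnorm SX SY A in op.
(* Young's inequality, as a completed square. *)
have young : l * a * N <= L / (2 * b) * a ^+ 2 + b * (2^-1 * N ^+ 2).
  rewrite -subr_ge0 /LA -/l.
  have -> : l ^+ 2 / (2 * b) * a ^+ 2 + b * (2^-1 * N ^+ 2) - l * a * N
    = (2 * b)^-1 * (l * a - b * N) ^+ 2 by field; rewrite gt_eqF.
  by rewrite mulr_ge0 ?sqr_ge0// invr_ge0 mulr_ge0// ltW.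
have split_dot w : dot (A *m x) w = dot (A *m u) w + dot (A *m (x - u)) w.
  by rewrite -dotDl -mulmxDr addrC subrK.
move: growth dual; rewrite /phi !split_dot (dotDr z) dotNr; lra.
Qed.

Lemma prox_step_dom x : dom f x -> dom f x1.
Proof.
move=> xdom; have := x1_argmin.2 x I; rewrite -(fineK (f_fin xdom)) -!EFinD.
rewrite /dom /= ltey; apply: contraPneq => ->.
by rewrite !addye// leNgt ltry.
Qed.

Lemma prox_step x : dom f x ->
  F x1 + dot (A *m (x1 - u)) y + L / (2 * b) * wnorm SX (x1 - u) ^+ 2
    + L / (2 * b) * wnorm SX (x - x1) ^+ 2
  <= F x + dot (A *m (x - u)) y + L / (2 * b) * wnorm SX (x - u) ^+ 2.
Proof.
move=> xdom; have x1dom := prox_step_dom xdom.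
pose phi w := F w + dot (A *m (w - u)) y + L / (2 * b) * wnorm SX (w - u) ^+ 2.
have objective w : dom f w ->
    (f w + (dot (A^T *m y) (w - u))%:E
      + (L / (2 * b) * wnorm SX (w - u) ^+ 2)%:E)%E = (phi w)%:E.
  move=> wdom; rewrite -(fineK (f_fin wdom)) -!EFinD /phi.
  by rewrite dotC dot_mulmxl.
apply: (@minimizer_growth R 'cV[R]_n phi) => s s01.
  have [mdom _] := f_convex_real s01 xdom x1dom.
  by have := x1_argmin.2 _ I; rewrite -lee_fin -!objective//; exact.
have [mdom] := f_convex_real s01 xdom x1dom.
rewrite /phi wnorm_sqr_conv !mulmxBr mulmxDr -!scalemxAr !dotE; lra.
Qed.

Lemma smoothed_lagrangian_step x z : dom f x -> dom (fconj g) z ->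
  lag b x1 z + L / (2 * b) * wnorm SX (x - x1) ^+ 2
  <= lag b x y + L / (2 * b) * wnorm SX (x - u) ^+ 2.
Proof.
move=> xdom zdom; have := dual_step x1 zdom; have := prox_step xdom.
rewrite /lag !mulmxBr !dotE; lra.
Qed.

End Iteration.

Lemma lag_le_primal b x y : dom (fconj g) y ->
  lag b x y <= F x + G (A *m x) - b * breg y.
Proof. by move=> /(fenchel_young g_fin (A *m x)); rewrite /lag; lra. Qed.

(** Lowering the smoothing from [b0] to [b] costs [(b0 - b) * breg y] at [x], which
    is paid for by the negative regularization term [- b * breg y] at [xs]. *)
Lemma smoothed_lagrangian_conv b b0 t x xs y : 0 < t < 1 ->
  (1 - t) * (b0 - b) <= t * b -> dom f x -> dom f xs -> dom (fconj g) y ->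
  lag b (t *: xs + (1 - t) *: x) y
  <= t * (F xs + G (A *m xs)) + (1 - t) * lag b0 x y.
Proof.
move=> t01 tb xdom xsdom ydom; have /andP[t0 t1] := t01.
have [_ Fconv] := f_convex_real t01 xsdom xdom.
have := fenchel_young g_fin (A *m xs) ydom; rewrite -(ler_pM2l t0).
have := ler_wpM2r (breg_ge0 ydom) tb.
rewrite /lag mulmxDr -!scalemxAr !dotE; lra.
Qed.

(** The potential is
    [lag - v + tau k ^+ 2 / beta k.+1 * (L / 2 * |xs - xt k|^2)] divided by
    [tau k ^+ 2 / beta k.+1]; it does not increase.  The auxiliary points [xt]
    make both distances in [smoothed_lagrangian_step] multiples of successive
    terms of one sequence.  The bound is kept for all dual points [z] at once, but
    the induction only uses it at [z = ystar k.+1]: there is no need for the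
    smoothed supremum. *)
Lemma smoothed_gap_bound (beta1 : R) tau beta xbar xhat ystar xs :
  0 < beta1 ->
  asgard SX SY f g A p gradp 1 yc beta1 tau beta xbar xhat ystar ->
  dom f xs -> forall k z, dom (fconj g) z ->
  lag (beta k.+1) (xbar k.+1) z - (F xs + G (A *m xs))
  <= tau k ^+ 2 / beta k.+1 * (L / 2 * wnorm SX (xbar 0 - xs) ^+ 2).
Proof.
move=> b1 alg xsdom.
have [tau0 tau_bd root betaS] := asgard_parameters alg.
have beta1_gt0 : 0 < beta 1 by rewrite (asgard_beta1 alg).
have bgt0 := beta_gt0 tau0 tau_bd beta1_gt0 betaS.
have tgt0 := tau_gt0 tau0 tau_bd.
set v := F xs + G (A *m xs).
pose xt k := xbar k + (tau k)^-1 *: (xbar k.+1 - xbar k).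
have ydom k : dom (fconj g) (ystar k) := argmax_dom (asgard_ystar alg k).
have xdom k : dom f (xbar k.+1) := prox_step_dom (asgard_xbar alg k) xsdom.
have step k := smoothed_lagrangian_step (bgt0 k) (asgard_ystar alg k)
  (asgard_xbar alg k).
have L0 : 0 <= L by rewrite sqr_ge0.
suff bound k z : dom (fconj g) z ->
    lag (beta k.+1) (xbar k.+1) z - v
      + tau k ^+ 2 / beta k.+1 * (L / 2 * wnorm SX (xs - xt k) ^+ 2)
    <= tau k ^+ 2 / beta k.+1 * (L / 2 * wnorm SX (xbar 0 - xs) ^+ 2).
  move=> k z zdom; apply: le_trans (bound k z zdom); rewrite lerDl.
  apply: mulr_ge0; apply: mulr_ge0; rewrite ?sqr_ge0 ?invr_ge0//.
    exact: ltW.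
  exact: mulr_ge0.
elim: k z => [|k IH] z zdom.
  have := step 0 xs z xsdom zdom; rewrite (asgard_xhat0 alg).
  have := lag_le_primal (beta 1) xs (ydom 0).
  have := mulr_ge0 (ltW (bgt0 0)) (breg_ge0 (ydom 0)).
  have -> : xt 0 = xbar 1 by rewrite /xt tau0 invr1 scale1r addrC subrK.
  have -> : L / (2 * beta 1) = tau 0 ^+ 2 / beta 1 * (L / 2).
    by rewrite tau0; field; rewrite gt_eqF.
  rewrite (wnorm_sqrC SX xs (xbar 0)) -/v; lra.
set t := tau k.+1; set x := t *: xs + (1 - t) *: xbar k.+1.
have t01 : 0 < t < 1 := tau_bd k.
have [mdom _] := f_convex_real t01 xsdom (xdom k).
have xE2 : x - xbar k.+2 = t *: (xs - xt k.+1).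
  apply/colP => i; rewrite /x /xt !mxE -/t; field.
  by rewrite gt_eqF// tgt0.
have xEhat : x - xhat k.+1 = t *: (xs - xt k).
  apply/colP => i; rewrite /x /xt (asgard_xhat alg) !mxE -/t; field.
  by rewrite gt_eqF.
have decrease : (1 - t) * (beta k.+1 - beta k.+2) <= t * beta k.+2.
  have t1 : 0 < 1 + t by rewrite addr_gt0// tgt0.
  have -> : beta k.+1 - beta k.+2 = t * beta k.+2.
    by rewrite betaS -/t; field; rewrite gt_eqF.
  rewrite ler_piMl ?mulr_ge0 ?(ltW (tgt0 _)) ?(ltW (bgt0 _))//.
  by rewrite lerBlDr lerDl ltW// tgt0.
have stepk := step k.+1 x z mdom zdom.
have scale w w' : w = t *: w' -> L / (2 * beta k.+2) * wnorm SX w ^+ 2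
    = t ^+ 2 / beta k.+2 * (L / 2 * wnorm SX w' ^+ 2).
  by move=> ->; rewrite wnorm_sqrZ; field; rewrite gt_eqF.
rewrite (scale _ _ xE2) (scale _ _ xEhat) in stepk.
have conv := smoothed_lagrangian_conv t01 decrease (xdom k) xsdom (ydom k.+1).
have t1 : 0 <= 1 - t by rewrite subr_ge0 (tau_le1 tau0 tau_bd).
have IHk := ler_wpM2l t1 (IH _ (ydom k.+1)).
rewrite mulrDr !(mulrA (1 - t) (_ / _)) in IHk.
rewrite -(tau_beta_telescope tau0 tau_bd root beta1_gt0 betaS k) in IHk.
exact: potential_decrease stepk conv IHk.
Qed.

(** Since [G (A *m x)] is the supremum of [dot (A *m x) z - h z], undoing the
    smoothing costs at most [b] times the largest Bregman distance. *)
Lemma primal_le_of_lagrangian (b d c K : R) x :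
  0 <= b -> 0 <= K -> (forall u v, `|G u - G v| <= K * `|u - v|) -> econvex g ->
  (forall z, dom (fconj g) z -> breg z <= d) ->
  (forall z, dom (fconj g) z -> lag b x z <= c) ->
  F x + G (A *m x) <= c + b * d.
Proof.
move=> b0 K0 GK g_convex bd bc; apply/ler_addgt0Pr => e e0.
have Gconv u v s : 0 < s < 1 ->
    G (s *: u + (1 - s) *: v) <= s * G u + (1 - s) * G v.
  move=> s01; have := g_convex u v s s01.
  rewrite -(fineK (g_fin u)) -(fineK (g_fin v)) -(fineK (g_fin (_ + _))).
  by rewrite -!EFinM -EFinD lee_fin.
have [z [a [za Gz]]] := affine_minorant_approx (A *m x) K0 e0 GK Gconv.
have [zdom hz] := fconj_finite_le g_fin za.
have := bc _ zdom; have := ler_wpM2l b0 (bd _ zdom); rewrite /lag; lra.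
Qed.

End Convergence.

Theorem theorem3p3 (R : realType) (n m q r : nat)
  (f : 'cV[R]_n -> \bar R) (g : 'cV[R]_m -> \bar R) (A : 'M[R]_(m, n))
  (SX : 'M[R]_(q, n)) (SY : 'M[R]_(r, m))
  (p : 'cV[R]_m -> \bar R) (gradp : 'cV[R]_m -> 'cV[R]_m) (Lb : R)
  (yc : 'cV[R]_m)
  (f_proper : proper_efun f) (f_closed : lower_semicontinuous f)
  (f_convex : econvex f)
  (g_proper : proper_efun g) (g_closed : lower_semicontinuous g)
  (g_convex : econvex g)
  (sol_neq0 : solutions f g A !=set0)
  (ri_cond : relint [set u - A *m x | u in dom g & x in dom f] 0)
  (SX_posdef : posdef (SX^T *m SX)) (SY_posdef : posdef (SY^T *m SY))
  (Lb_ge1 : 1 <= Lb)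
  (p_prox : prox_function SY p gradp Lb)
  (p_dom : closure (dom (fconj g)) `<=` dom p)
  (yc_center : prox_center p yc) (p_yc : p yc = 0%E)
  (g_fin : forall u, g u \is a fin_num) (g_lip : lipschitz (fine \o g)) :
  let D := dual_diameter g p gradp yc in
  (D < +oo)%E /\
  (Lb = 1 ->
   forall (beta1 : R) (tau beta : nat -> R) (xbar xhat : nat -> 'cV[R]_n)
     (ystar : nat -> 'cV[R]_m),
     0 < beta1 ->
     asgard SX SY f g A p gradp Lb yc beta1 tau beta xbar xhat ystar ->
     forall xs, solutions f g A xs ->
     forall k : nat, (1 <= k)%N ->
     (primal f g A (xbar k) - primal_opt f g A
      <= (LA SX SY A / (2 * beta1 * k%:R)
            * wnorm SX (xbar 0%N - xs) ^+ 2)%:E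
         + (2 * beta1 / (k%:R + 1))%:E * D)%E).
Proof.
have ycdom := yc_center.1.
have domgp : dom (fconj g) `<=` dom p.
  by move=> y ydom; apply/p_dom/subset_closure.
have D_fin : (dual_diameter g p gradp yc < +oo)%E.
  by apply: (dual_diameter_finite SY_posdef p_prox _ ycdom) => //; lra.
move=> D; split => // Lb1 beta1 tau beta xbar xhat ystar b1 alg xs xs_sol k k1.
case: k k1 => // k _; rewrite {}Lb1 in p_prox alg.
have [K K0 GK] := lipschitz_bound g_lip.
have optE : primal_opt f g A = primal f g A xs.
  apply/eqP; rewrite eq_le; apply/andP; split.
    by apply: ereal_inf_lbound; exists xs.
  by apply: le_ereal_inf_tmp => _ [x _ <-]; exact: xs_sol.2.
have xsdom : dom f xs.
  have [x xdom] := f_proper.2; have := xs_sol.2 x I.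
  rewrite /primal -(fineK (f_fin f_proper xdom)) -(fineK (g_fin (A *m x))).
  rewrite -(fineK (g_fin (A *m xs))) -EFinD /dom /= ltey.
  by apply: contraPneq => ->; rewrite addye// leNgt ltry.
have xdom j : dom f (xbar j.+1) :=
  prox_step_dom f_proper (asgard_xbar alg j) xsdom.
have primalE x : dom f x ->
    primal f g A x = ((fine \o f) x + (fine \o g) (A *m x))%:E.
  by move=> /(f_fin f_proper) xfin; rewrite EFinD /primal /= !fineK.
have ydom := argmax_dom g_fin p_prox p_dom ycdom (asgard_ystar alg 0).
have bregD z : dom (fconj g) z -> (bregman p gradp z yc <= D)%E.
  by move=> zdom; apply: ereal_sup_ubound; exists z.
have D_ge0 : (0 <= D)%E.
  exact: le_trans (bregman_ge0 p_prox (domgp _ ydom) ycdom) (bregD _ ydom).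
have Dfin : D \is a fin_num by rewrite ge0_fin_numE.
have breg_le z : dom (fconj g) z -> fine (bregman p gradp z yc) <= fine D.
  move=> zdom; apply: fine_le => //; last exact: bregD.
  exact: (bregman_fin p_prox ycdom (domgp _ zdom)).
have [tau0 tau_bd root betaS] := asgard_parameters alg.
have beta1_gt0 : 0 < beta 1 by rewrite (asgard_beta1 alg).
have gap := smoothed_gap_bound f_proper f_convex g_fin SX_posdef SY_posdef
  p_prox p_dom ycdom b1 alg xsdom.
have lag_le z (zdom : dom (fconj g) z) := gap k z zdom.
set c := tau k ^+ 2 / beta k.+1 * _ in lag_le.
set v := (fine \o f) xs + _ in lag_le.
have H := @primal_le_of_lagrangian R n m f g A p gradp yc g_fin (beta k.+1)
  (fine D) (c + v) K (xbar k.+1)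
  (ltW (beta_gt0 tau0 tau_bd beta1_gt0 betaS k)) K0 GK g_convex breg_le.
rewrite optE !primalE// -(fineK Dfin) -EFinB -EFinM -EFinD lee_fin.
have c_le : c <= LA SX SY A / (2 * beta1 * k.+1%:R)
    * wnorm SX (xbar 0%N - xs) ^+ 2.
  have -> : LA SX SY A / (2 * beta1 * k.+1%:R) * wnorm SX (xbar 0%N - xs) ^+ 2
    = (beta 1 * k.+1%:R)^-1 * (LA SX SY A / 2 * wnorm SX (xbar 0%N - xs) ^+ 2).
    rewrite (asgard_beta1 alg); field.
    by rewrite (gt_eqF b1) nat1r pnatr_eq0.
  rewrite ler_wpM2r ?(tau_beta_le tau0 tau_bd root beta1_gt0 betaS)//.
  by apply: mulr_ge0; [apply: mulr_ge0 => //; exact: sqr_ge0 | exact: sqr_ge0].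
have b_le : beta k.+1 * fine D <= 2 * beta1 / (k.+1%:R + 1) * fine D.
  rewrite ler_wpM2r ?fine_ge0// natr1 -(asgard_beta1 alg).
  exact: (beta_le tau0 tau_bd root beta1_gt0 betaS).
have : (fine \o f) (xbar k.+1) + (fine \o g) (A *m xbar k.+1)
    <= c + v + beta k.+1 * fine D.
  by apply: H => z zdom; rewrite -lerBlDr; exact: lag_le.
by rewrite lerBlDr (addrAC c) => /le_trans; apply; rewrite lerD2r lerD.
Qed.
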